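(* Let $\lambda\in(1/2,2)$ and $\nu\ge\lambda$. There exists a value $\mathcal C_\nu^{(K)}(\lambda)>0$ such that $$\mathcal L_\nu^{(K)}(\lambda,x)=\frac1x\left(\nu+\lambda+\sqrt{(\nu-\lambda)^2+\mathcal C_\nu^{(K)}(\lambda)\,x^2}\right)$$ satisfies $$h_\nu(x)=\frac{K_{\nu+1}(x)}{K_\nu(x)}\ge\mathcal L_\nu^{(K)}(\lambda,x),\qquad x>0,$$ where, for fixed $\nu$ and $\lambda$, the equality holds at one and only one value of the variable $x_*=x_\nu^{(K)}(\lambda)>0$, where $h_\nu'(x_* )=\mathcal L_\nu^{(K)\prime}(\lambda,x_* )$. As a function of $\lambda$, both $\mathcal C_\nu^{(K)}(\lambda)$ and $x_\nu^{(K)}(\lambda)$ are decreasing, and the following limits hold: $$\lim_{\lambda\to1/2}\mathcal C_\nu^{(K)}(\lambda)=1,\qquad \lim_{\lambda\to2}\mathcal C_\nu^{(K)}(\lambda)=\frac{\nu-2}{\nu-1},$$ $$\lim_{\lambda\to1/2}x_\nu^{(K)}(\lambda)=+\infty,\qquad \lim_{\lambda\to2}x_\nu^{(K)}(\lambda)=0.$$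
   Context: $K_\nu$ denotes the modified Bessel function of the second kind of order $\nu$. Primes denote derivatives with respect to $x$.
   Formalization: The case ν=λ is excluded, since there h−2ν/x=K_{ν-1}/K_ν→0 as x→0+ (e.g. x/(x+1) for ν=λ=3/2), so no C>0 works; the limits as λ→2 (from the left) are stated for ν≥2, as otherwise λ≤ν keeps λ away from 2. *)

(* Defs.v *)
From HB Require Import structures.
From mathcomp Require Import all_boot all_order all_algebra.
From mathcomp Require Import all_classical all_reals all_analysis.
Import Order.TTheory GRing.Theory Num.Theory.
Import numFieldNormedType.Exports.

Set Implicit Arguments.
Unset Strict Implicit.
Unset Printing Implicit Defensive.

Local Open Scope classical_set_scope.
Local Open Scope ring_scope.

Definition cosh (R : realType) (t : R) : R := (expR t + expR (- t)) / 2.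

(* Modified Bessel function of the second kind, by its classical integral
   K_nu(x) = \int_0^oo exp (- x cosh t) cosh (nu t) dt.  The integral converges,
   and gives K_nu, exactly for x > 0; values at x <= 0 are meaningless. *)
Definition besselK (R : realType) (nu x : R) : R :=
  Rintegral (@lebesgue_measure R) `[0, +oo[%classic
    (fun t => expR (- (x * cosh t)) * cosh (nu * t)).

Definition ratioK (R : realType) (nu x : R) : R :=
  besselK (nu + 1) x / besselK nu x.

(* The bound L_nu^(K)(la, x), with the constant C_nu^(K)(la) as a parameter c. *)
Definition boundK (R : realType) (nu la c x : R) : R :=
  x^-1 * (nu + la + Num.sqrt ((nu - la) ^+ 2 + c * x ^+ 2)).

(* Main.v *)
Require Import Defs.
From HB Require Import structures.
From mathcomp Require Import all_boot all_order all_algebra.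
From mathcomp Require Import all_classical all_reals all_analysis.
From mathcomp Require Import measurable_realfun ring lra.
Import Order.TTheory GRing.Theory Num.Theory.
Import numFieldNormedType.Exports.
Local Open Scope classical_set_scope.
Local Open Scope ring_scope.

(** Put u(x) = x K_(nu-1)(x) / K_nu(x) ([redratio]).  The three-term recurrence
    gives K_(nu+1)(x) / K_nu(x) = (u + 2 nu) / x, so squaring turns the bound
    with constant c into c <= F(x), where
    F(x) = u (u + 2 (nu - la)) / x^2 ([envelope]).  Hence the best constant is
    the minimum of F, the contact point is where it is attained, and everything
    rests on F decreasing strictly and then increasing strictly.

    The function u solves the Riccati equation x u' = u (u + 2 nu) - x^2, and
    F' has the sign of D(x) = u (u + 2 nu - 1 - r) - x^2 ([crit]), where
    r = (nu - la) / (u + nu - la).  Along the solution, D obeys a linear equation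
    x D' = u E + k D with k > 0 ([is_derive_crit]), whose source term is
    E = (1 - r) ((1 + r)^2 - 2 la).  As u increases from 0 to infinity, r
    decreases from 1 to 0, so for 1/2 < la < 2 the source changes sign once, from
    positive to negative.  While E > 0, D cannot come back to 0 from above.
    While E < 0, D cannot come back to 0 from below; moreover D <= 0 would
    force D to blow up like - x^3, while D >= - x^2 far away
    ([linear_ode_gt0]), so D > 0 throughout that region.  Together: once D is
    nonnegative it is positive afterwards ([crit_gt0_after]).  So D has at most
    one zero, and it has one as soon as it is negative somewhere.  That is read
    off from K near 0, by comparing u for the orders nu, nu - 1, nu - 2
    ([crit_bessel_lt0]).

    At the end points the source has a constant sign: D < 0 everywhere for
    la = 1/2 and D > 0 everywhere for la = 2 <= nu.  By continuity of D in la, the zero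
    of D escapes to infinity, respectively tends to 0.  The limits of the constant
    then follow by squeezing F between explicit functions of the contact point,
    using x - nu < u <= x at infinity and x^2 = u (w + 2 (nu - 1)), 0 < w <= x,
    near 0.  Monotonicity in la holds because F decreases and D increases with la
    at a fixed x.

    The facts about K come from its integral: differentiation under the integral
    sign, and integration by parts for the recurrence, both dominated by a
    multiple of exp (- t). *)

Set Implicit Arguments.
Unset Strict Implicit.
Unset Printing Implicit Defensive.

(** * Exponential integrals over the half-line *)

Section BesselIntegrals.
Variable R : realType.
Implicit Types (m x t : R).
Notation mu := (@lebesgue_measure R).

Definition expcosh m x t : R := expR (m * t - x * cosh t).

(** With t ranging over the half-line only, K_m is the even part in m of this
    integral; a single exponential is simpler to differentiate and to integrate
    by parts than a hyperbolic cosine. *)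
Definition halfK m x : R := Rintegral mu `[0, +oo[ (expcosh m x).

Lemma expcoshD m n x t : expcosh (m + n) x t = expcosh m x t * expR (n * t).
Proof. by rewrite /expcosh -expRD; congr expR; ring. Qed.

Lemma is_derive_expcosh_t m x t : is_derive t 1 (expcosh m x)
  (m * expcosh m x t - x / 2 * (expcosh (m + 1) x t - expcosh (m - 1) x t)).
Proof.
rewrite !expcoshD mulN1r mul1r /expcosh /cosh; set e := (fun t => _).
have -> : e = fun t => expR (m * t - x * (2^-1 * (expR t + expR (- t)))).
  by apply/funext => s; rewrite /e [2^-1 * _]mulrC.
by apply: is_derive_eq; rewrite /GRing.scale/= [2^-1 * (_ + expR _)]mulrC; ring.
Qed.

Lemma is_derive_expcosh_x m x t : is_derive x 1 (fun x => expcosh m x t)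
  (- (expcosh (m + 1) x t + expcosh (m - 1) x t) / 2).
Proof.
rewrite !expcoshD mulN1r mul1r /expcosh.
by apply: is_derive_eq; rewrite /GRing.scale/= /cosh; ring.
Qed.

Lemma expcosh_gt0 m x t : 0 < expcosh m x t.
Proof. exact: expR_gt0. Qed.

Lemma continuous_expcosh m x : continuous (expcosh m x).
Proof.
by move=> t; apply/differentiable_continuous/derivable1_diffP; case: (is_derive_expcosh_t m x t).
Qed.

Lemma cosh_ge t : 0 <= t -> t ^+ 2 / 4 <= cosh t.
Proof.
move=> t0; have := @expR_ge1Dxn R t 1 t0; have := expR_gt0 (- t).
rewrite /cosh (_ : 2`!%:R = 2 :> R) //; lra.
Qed.

(** The constant does not depend on [x], so the bound dominates the integrand and
    its derivatives on a neighbourhood of each positive point.  It comes from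
    cosh t >= t^2 / 4 by completing the square. *)
Lemma expcosh_le_exp m d : 0 < d -> exists2 C, 0 < C &
  forall x t, d <= x -> 0 <= t -> expcosh m x t <= C * expR (- t).
Proof.
move=> d0; exists (expR ((m + 1) ^+ 2 / d)) => [|x t dx t0]; first exact: expR_gt0.
rewrite /expcosh -expRD ler_expR.
have ct := cosh_ge t0.
have h : d * (t ^+ 2 / 4) <= x * cosh t by apply: ler_pM => //; [exact: ltW|nra].
suff : (m + 1) * t - d * (t ^+ 2 / 4) <= (m + 1) ^+ 2 / d by lra.
have : 0 <= (d * t / 2 - (m + 1)) ^+ 2 / d by rewrite divr_ge0 ?sqr_ge0 // ltW.
suff -> : (d * t / 2 - (m + 1)) ^+ 2 / d = d * t ^+ 2 / 4 - (m + 1) * t + (m + 1) ^+ 2 / d by lra.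
by field; rewrite gt_eqF.
Qed.

Lemma cvg_expRNy (C : R) : C * expR (- t) @[t --> +oo] --> (0 : R).
Proof. by rewrite -(mulr0 C); apply: cvgMr; exact: cvgr_expR. Qed.

Lemma continuous_expN (C : R) : continuous (fun t : R => C * expR (- t)).
Proof.
move=> t; apply: cvgMr; apply: continuous_comp; first exact: continuousN.
exact: continuous_expR.
Qed.

Lemma integral_expN (C : R) : 0 <= C ->
  (\int[mu]_(t in `[0%R, +oo[) (C * expR (- t))%:E = C%:E)%E.
Proof.
move=> C0.
have dF t : is_derive t 1 (fun t => - (C * expR (- t))) (C * expR (- t)).
  by apply: is_derive_eq; rewrite /GRing.scale/=; ring.
have cF := @continuous_expN C.
rewrite (@ge0_continuous_FTC2y _ _ (fun t => - (C * expR (- t))) 0 0).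
- by rewrite oppr0 expR0 mulr1 -EFinB sub0r opprK.
- by move=> x _; rewrite mulr_ge0 // expR_ge0.
- exact: continuous_subspaceT.
- by rewrite -oppr0; apply: cvgN; exact: cvg_expRNy.
- by move=> t _; case: (dF t).
- by apply: cvg_at_right_filter; apply: cvgN; exact: cF.
- by move=> t _; rewrite derive1E derive_val.
Qed.

Lemma measurable_half_line (f : R -> R) : continuous f ->
  measurable_fun `[(0 : R), +oo[ (EFin \o f).
Proof.
move=> cf; apply/measurable_EFinP; apply: measurable_funTS.
exact: continuous_measurable_fun.
Qed.

Lemma integrable_dominated (f : R -> R) (C : R) : continuous f -> 0 <= C ->
  (forall t, 0 <= t -> `|f t| <= C * expR (- t)) ->
  mu.-integrable `[0, +oo[ (EFin \o f).
Proof.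
move=> cf C0 fC.
apply: (@le_integrable _ _ _ mu _ _ _ (EFin \o (fun t : R => C * expR (- t)))) => //.
- exact: measurable_half_line.
- move=> t /=; rewrite in_itv/= andbT => t0; rewrite lee_fin (le_trans (fC _ t0)) //.
  exact: ler_norm.
- apply/integrableP; split; first by apply: measurable_half_line; exact: continuous_expN.
  rewrite (_ : integral _ _ _ = C%:E) ?ltry // -(integral_expN C0).
  by apply: eq_integral => t _; rewrite gee0_abs // lee_fin mulr_ge0 ?expR_ge0.
Qed.

Lemma integrable_expcosh m x : 0 < x -> mu.-integrable `[0, +oo[ (EFin \o expcosh m x).
Proof.
move=> x0; have [C C0 hC] := expcosh_le_exp m x0.
apply: (@integrable_dominated _ C); [exact: continuous_expcosh|exact: ltW|move=> t t0].
by rewrite ger0_norm ?hC // ltW // expcosh_gt0.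
Qed.

Lemma is_derive_halfK m x : 0 < x ->
  is_derive x 1 (halfK m) (- (halfK (m + 1) x + halfK (m - 1) x) / 2).
Proof.
move=> x0.
have [C1 C10 h1] := @expcosh_le_exp (m + 1) _ (divr_gt0 x0 (ltr0n R 2)).
have [C2 C20 h2] := @expcosh_le_exp (m - 1) _ (divr_gt0 x0 (ltr0n R 2)).
have Ix : `]x / 2, (2 * x)[%classic x by rewrite /= in_itv/=; lra.
have Ip y : `]x / 2, (2 * x)[%classic y -> 0 < y by rewrite /= in_itv/=; lra.
have d1E y t : partial1of2 (expcosh m) y t =
    - (expcosh (m + 1) y t + expcosh (m - 1) y t) / 2.
  by rewrite partial1of2E; have := is_derive_expcosh_x m y t => ?; rewrite derive_val.
have C0 : 0 <= C1 + C2 by lra.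
have intG : mu.-integrable `[0, +oo[ (EFin \o (fun t => (C1 + C2) * expR (- t))).
  apply: (integrable_dominated _ C0) => [|t _]; first exact: continuous_expN.
  by rewrite ger0_norm // mulr_ge0 ?expR_ge0.
have intf y (Iy : `]x / 2, (2 * x)[%classic y) := integrable_expcosh m (Ip y Iy).
have derf y t : `]x / 2, (2 * x)[%classic y -> `[0, +oo[%classic t ->
    derivable (expcosh m ^~ t) y 1.
  by move=> _ _; case: (is_derive_expcosh_x m y t).
have G0 (t : R) : 0 <= (C1 + C2) * expR (- t) by rewrite mulr_ge0 ?expR_ge0.
have Gub y t : `]x / 2, (2 * x)[%classic y -> `[0, +oo[%classic t ->
    `|partial1of2 (expcosh m) y t| <= (C1 + C2) * expR (- t).
  rewrite /= !in_itv/= andbT => /andP[y1 _] t0; rewrite d1E mulNr normrN.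
  have := h1 y t (ltW y1) t0; have := h2 y t (ltW y1) t0.
  have := expcosh_gt0 (m + 1) y t; have := expcosh_gt0 (m - 1) y t.
  by move=> ? ? ? ?; rewrite ger0_norm; lra.
apply: DeriveDef.
  by apply: (derivable_under_integral _ Ix intf derf G0 intG Gub).
rewrite -derive1E (differentiation_under_integral _ Ix intf derf G0 intG Gub) //.
rewrite /halfK -RintegralD //; try exact: integrable_expcosh.
rewrite mulrC mulrN -mulNr -RintegralZl //; last first.
  exact: (integrableD _ (integrable_expcosh _ x0) (integrable_expcosh _ x0)).
by apply: eq_Rintegral => t _; rewrite d1E mulNr mulrC -mulNr.
Qed.

(** Integration by parts: the left-hand side integrates the derivative in [t] of
    [expcosh m x], which tends to 0 at infinity and is exp (- x) at 0. *)
Lemma halfK_rec m x : 0 < x ->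
  m * halfK m x - x / 2 * (halfK (m + 1) x - halfK (m - 1) x) = - expR (- x).
Proof.
move=> x0.
have [C0 C00 h0] := @expcosh_le_exp m _ x0.
have [C1 C10 h1] := @expcosh_le_exp (m + 1) _ x0.
have [C2 C20 h2] := @expcosh_le_exp (m - 1) _ x0.
pose C := `|m| * C0 + x / 2 * (C1 + C2).
have C_ge0 : 0 <= C by rewrite addr_ge0 ?mulr_ge0 //; lra.
pose df t := m * expcosh m x t - x / 2 * (expcosh (m + 1) x t - expcosh (m - 1) x t).
have dfN t : 0 <= t -> - (C * expR (- t)) <= df t.
  move=> t0; rewrite /df /C.
  have := h0 x t (lexx _) t0; have := h1 x t (lexx _) t0; have := h2 x t (lexx _) t0.
  have := expcosh_gt0 m x t; have := expcosh_gt0 (m + 1) x t.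
  have := expcosh_gt0 (m - 1) x t; have := ler_norm (- m); rewrite normrN.
  set e := expR _; move=> mm p2 p1 p0 l2 l1 l0.
  have : `|m| * expcosh m x t <= `|m| * (C0 * e) by rewrite ler_wpM2l.
  have : - m * expcosh m x t <= `|m| * expcosh m x t by rewrite ler_wpM2r // ltW.
  have : x * expcosh (m + 1) x t <= x * (C1 * e) by rewrite ler_wpM2l // ltW.
  have : 0 <= x * expcosh (m - 1) x t by rewrite mulr_ge0 // ltW.
  have : 0 <= x * (C2 * e) by rewrite mulr_ge0 ?(le_trans _ l2) // ltW.
  by lra.
have cdf : continuous df.
  move=> t; apply: cvgB; first by apply: cvgMr; exact: continuous_expcosh.
  by apply: cvgMr; apply: cvgB; exact: continuous_expcosh.
have dF t : is_derive t 1 (fun t => expcosh m x t - C * expR (- t)) (df t + C * expR (- t)).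
  have := is_derive_expcosh_t m x t => ?.
  by apply: is_derive_eq; rewrite /GRing.scale/= /df; ring.
have cF : continuous (fun t => expcosh m x t - C * expR (- t)).
  by move=> t; apply: cvgB; [exact: continuous_expcosh|exact: continuous_expN].
(* Adding C exp (- t) makes the integrand nonnegative, as the improper
   fundamental theorem of calculus requires. *)
have : Rintegral mu `[0, +oo[ (fun t => df t + C * expR (- t)) =
       0 - (expcosh m x 0 - C * expR (- 0)).
  apply: (@Rintegral_ge0_continuous_FTC2y _ _ (fun t => expcosh m x t - C * expR (- t))).
  - by move=> t t0; have := dfN t t0; lra.
  - by apply: continuous_subspaceT => t; apply: cvgD; [exact: cdf|exact: continuous_expN].
  - rewrite -(subrr 0); apply: cvgB; last exact: cvg_expRNy.
    apply: (squeeze_cvgr _ (cvg_cst 0) (cvg_expRNy C0)).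
    apply: filterS (nbhs_pinfty_ge (num_real 0)) => t t0.
    by rewrite (ltW (expcosh_gt0 _ _ _)) h0.
  - by move=> t _; case: (dF t).
  - by apply: cvg_at_right_filter; exact: cF.
  - by move=> t _; rewrite derive1E derive_val.
have iE n := integrable_expcosh n x0.
have iB : mu.-integrable `[0, +oo[ (EFin \o (fun t => expcosh (m + 1) x t - expcosh (m - 1) x t)).
  exact: (integrableB _ (iE _) (iE _)).
have iZ (r : R) (f : R -> R) : mu.-integrable `[0, +oo[ (EFin \o f) ->
    mu.-integrable `[0, +oo[ (EFin \o (fun t => r * f t)).
  by move=> /integrableZl; apply.
have idf : mu.-integrable `[0, +oo[ (EFin \o df).
  exact: (integrableB _ (iZ _ _ (iE _)) (iZ _ _ iB)).
have iC : mu.-integrable `[0, +oo[ (EFin \o (fun t => C * expR (- t))).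
  apply: (integrable_dominated _ C_ge0) => [|t _]; first exact: continuous_expN.
  by rewrite ger0_norm // mulr_ge0 ?expR_ge0.
rewrite RintegralD //.
have -> : Rintegral mu `[0, +oo[ df = m * halfK m x - x / 2 * (halfK (m + 1) x - halfK (m - 1) x).
  by rewrite /df RintegralB ?RintegralZl ?RintegralB //; exact: iZ.
rewrite [X in _ + X](_ : _ = C); last by rewrite /Rintegral integral_expN.
have -> : expcosh m x 0 = expR (- x).
  by rewrite /expcosh /cosh mulr0 oppr0 expR0; congr expR; field.
by move=> e; apply: (addIr C); rewrite e oppr0 expR0 mulr1 sub0r opprB addrC.
Qed.

(** Already the part of the integral over [0, 1] is at least a positive constant. *)
Lemma halfK_gt0 m x : 0 < x -> 0 < halfK m x.
Proof.
move=> x0; pose c := expR (- `|m| - x * expR 1).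
have cle t : 0 <= t <= 1 -> c <= expcosh m x t.
  move=> /andP[t0 t1]; rewrite ler_expR.
  have e1 : expR t <= expR 1 by rewrite ler_expR.
  have e2 : expR (- t) <= expR 1 by rewrite ler_expR; lra.
  have : x * cosh t <= x * expR 1 by rewrite ler_wpM2l ?(ltW x0) // /cosh; lra.
  have : - m * t <= `|m| * t by rewrite ler_wpM2r // -normrN ler_norm.
  have : `|m| * t <= `|m| by rewrite ler_piMr.
  lra.
have mT : measurable_fun setT (expcosh m x).
  by apply: continuous_measurable_fun; exact: continuous_expcosh.
have ci : (c%:E <= \int[mu]_(t in `[0%R, +oo[) (expcosh m x t)%:E)%E.
  apply: (@le_trans _ _ (\int[mu]_(t in `[0%R, 1%R]) (expcosh m x t)%:E)%E).
    apply: (@le_trans _ _ (\int[mu]_(t in `[0%R, 1%R]) (cst c%:E t))%E).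
      by rewrite integral_cst //= lebesgue_measure_itv/= lte_fin ltr01 -EFinB subr0 mule1.
    apply: ge0_le_integral => //.
    - by move=> t _; rewrite lee_fin expR_ge0.
    - by apply/measurable_EFinP; exact: measurable_funTS.
  apply: ge0_subset_integral => //.
  - by apply/measurable_EFinP; exact: measurable_funTS.
  - by move=> t _; rewrite lee_fin expR_ge0.
  - by apply: subset_itvl.
rewrite (@lt_le_trans _ _ c) ?expR_gt0 // /halfK /Rintegral.
rewrite -lee_fin fineK // ; exact: (integrable_fin_num _ (integrable_expcosh m x0)).
Qed.

End BesselIntegrals.

(** * Recurrences for K and the Riccati equation *)

Section BesselK.
Variable R : realType.
Implicit Types (nu x t : R).

Lemma besselKE nu x : 0 < x -> besselK nu x = (halfK nu x + halfK (- nu) x) / 2.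
Proof.
move=> x0; have iE n := integrable_expcosh n x0.
rewrite [RHS]mulrC /halfK -RintegralD; [|by []|exact: iE|exact: iE].
rewrite -RintegralZl //; last first.
  exact: (integrableD _ (iE _) (iE _)).
apply: eq_Rintegral => t _; rewrite /expcosh /cosh !expRD mulNr.
by ring.
Qed.

Lemma besselK_gt0 nu x : 0 < x -> 0 < besselK nu x.
Proof.
by move=> x0; rewrite besselKE // divr_gt0 // addr_gt0 // halfK_gt0.
Qed.

(** The boundary terms exp (- x) of [halfK_rec] for the orders nu and - nu cancel. *)
Lemma besselK_rec nu x : 0 < x ->
  besselK (nu + 1) x - besselK (nu - 1) x = 2 * nu / x * besselK nu x.
Proof.
move=> x0; have x_neq0 := lt0r_neq0 x0.
have := halfK_rec nu x0; have := halfK_rec (- nu) x0.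
rewrite !besselKE // !opprD opprK.
move: (halfK (nu + 1) x) (halfK (nu - 1) x) (halfK nu x) => a b c.
move: (halfK (- nu + 1) x) (halfK (- nu - 1) x) (halfK (- nu) x) => a' b' c' r' r.
apply: (mulfI x_neq0).
have -> : x * (2 * nu / x * ((c + c') / 2)) = nu * (c + c') by field.
by lra.
Qed.

Lemma is_derive_besselK nu x : 0 < x ->
  is_derive x 1 (besselK nu) (- (besselK (nu + 1) x + besselK (nu - 1) x) / 2).
Proof.
move=> x0.
have d1 := is_derive_halfK nu x0; have d2 := is_derive_halfK (- nu) x0.
have d : is_derive x 1 (fun x => 2^-1 * (halfK nu x + halfK (- nu) x))
    (- (besselK (nu + 1) x + besselK (nu - 1) x) / 2).
  apply: is_derive_eq; rewrite !besselKE // /GRing.scale/= !opprD opprK.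
  move: (halfK (nu + 1) x) (halfK (nu - 1) x) => a b.
  by move: (halfK (- nu + 1) x) (halfK (- nu - 1) x) => a' b'; ring.
apply: near_eq_is_derive d; near=> y.
rewrite besselKE 1?mulrC //.
near: y; exact: lt_nbhsr.
Unshelve. all: by end_near. Qed.

(** Pointwise on the integrands:
    cosh (nu t) - cosh ((nu - 1) t) = 2 sinh ((nu - 1/2) t) sinh (t / 2),
    where both factors are nonnegative. *)
Lemma besselK_pred_le nu x : 2^-1 <= nu -> 0 < x ->
  besselK (nu - 1) x <= besselK nu x.
Proof.
move=> nu2 x0; rewrite !besselKE // ler_pM2r //.
have iE n := integrable_expcosh n x0.
rewrite /halfK -(RintegralD _ (iE _) (iE _)) // -(RintegralD _ (iE _) (iE _)) //.
apply: le_Rintegral; first by [].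
- exact: (integrableD _ (iE _) (iE _)).
- exact: (integrableD _ (iE _) (iE _)).
move=> t /=; rewrite in_itv/= andbT => t0.
rewrite /expcosh !expRD -!mulrDl ler_pM2r ?expR_gt0 //.
have -> : (nu - 1) * t = nu * t + - t by ring.
have -> : - (nu - 1) * t = - nu * t + t by ring.
rewrite !expRD.
have -> : expR (- nu * t) = expR ((1 - nu) * t) * expR (- t) by rewrite -expRD; congr expR; ring.
have : expR ((1 - nu) * t) <= expR (nu * t) by rewrite ler_expR; nra.
have e1 : expR (- t) <= 1 by rewrite expR_le1; lra.
rewrite -(mulrA _ (expR (- t))) (mulrC (expR (- t)) (expR t)) expRxMexpNx_1 mulr1.
by nra.
Qed.

(** The part of x K_(nu+1) / K_nu that remains once the summand 2 nu of the recurrence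
    is removed; this is the form in which the ratio satisfies a Riccati equation
    and stays positive. *)
Definition redratio nu x : R := x * (besselK (nu - 1) x / besselK nu x).

Lemma redratio_gt0 nu x : 0 < x -> 0 < redratio nu x.
Proof. by move=> x0; rewrite mulr_gt0 // divr_gt0 // besselK_gt0. Qed.

Lemma ratioKE nu x : 0 < x -> ratioK nu x = (redratio nu x + 2 * nu) / x.
Proof.
move=> x0; have := besselK_rec nu x0; have := besselK_gt0 nu x0.
rewrite /ratioK /redratio.
move: (besselK (nu + 1) x) (besselK (nu - 1) x) (besselK nu x) => a b c c0 r.
have -> : a = b + 2 * nu / x * c by rewrite -r addrC subrK.
by field; rewrite !gt_eqF.
Qed.

(** Consecutive orders are linked by a continued fraction, because
    K_nu / K_(nu-1) is the reciprocal of K_(nu-1) / K_nu. *)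
Lemma redratio_shift nu x : 0 < x ->
  redratio nu x * (redratio (nu - 1) x + 2 * (nu - 1)) = x ^+ 2.
Proof.
move=> x0; have := ratioKE (nu - 1) x0; rewrite /ratioK subrK.
move=> h; have -> : redratio (nu - 1) x + 2 * (nu - 1) =
    x * (besselK nu x / besselK (nu - 1) x).
  by rewrite h mulrCA divff ?mulr1 // gt_eqF.
rewrite /redratio.
have := besselK_gt0 nu x0; have := besselK_gt0 (nu - 1) x0.
move: (besselK nu x) (besselK (nu - 1) x) => a b b0 a0.
by field; rewrite !gt_eqF.
Qed.

Lemma redratio_le nu x : 2^-1 <= nu -> 0 < x -> redratio nu x <= x.
Proof.
move=> nu2 x0; rewrite /redratio -[leRHS]mulr1 ler_pM2l // ler_pdivrMr ?besselK_gt0 //.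
by rewrite mul1r besselK_pred_le.
Qed.

Lemma is_derive_redratio nu x : 0 < x -> is_derive x 1 (redratio nu)
  ((redratio nu x * (redratio nu x + 2 * nu) - x ^+ 2) / x).
Proof.
move=> x0.
have d1 := is_derive_besselK nu x0; have d2 := is_derive_besselK (nu - 1) x0.
have K0 := besselK_gt0 nu x0.
have d3 := is_deriveV (lt0r_neq0 K0) d1.
have := besselK_rec nu x0; have := besselK_rec (nu - 1) x0; rewrite subrK in d2 *.
have -> : redratio nu = fun x => x * (besselK (nu - 1) x * (besselK nu x)^-1) by [].
move=> r2 r1; apply: is_derive_eq; rewrite /GRing.scale/=.
move: r1 r2 K0 x0; clear.
move: (besselK (nu + 1) x) (besselK (nu - 1 - 1) x) (besselK (nu - 1) x) (besselK nu x).
move=> a b c d r1 r2 d0 x0.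
have -> : a = c + 2 * nu / x * d by rewrite -r1 addrC subrK.
have -> : b = d - 2 * (nu - 1) / x * c by rewrite -r2 subKr.
by field; rewrite !gt_eqF.
Qed.

End BesselK.

(** * Barriers for differential inequalities *)

Section Barrier.
Variable R : realType.
Implicit Types (f df : R -> R) (x y : R).

Lemma is_derive_continuous f df (a b : R) :
  (forall x, a <= x <= b -> is_derive x 1 f (df x)) -> {within `[a, b], continuous f}.
Proof.
move=> fD; apply: derivable_within_continuous => x.
by rewrite in_itv/= => /fD[].
Qed.

Lemma is_derive_neg_descent f x b (d : R) : is_derive x 1 f d -> d < 0 -> x < b ->
  exists y, [/\ x < y, y < b & f y < f x].
Proof.
move=> [fD fd] d0 xb.
have : h^-1 *: (f (h *: 1 + x) - f x) @[h --> 0^'] --> d by rewrite -fd; exact: fD.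
move=> /cvgr_lt/(_ _ d0)[e /= e0 he].
pose h := Num.min (e / 2) ((b - x) / 2).
have h0 : 0 < h by rewrite lt_min; apply/andP; split; lra.
have h1 : h <= e / 2 by rewrite ge_min lexx.
have h2 : h <= (b - x) / 2 by rewrite ge_min lexx orbT.
exists (h + x); split; [lra|lra|].
have := he h; rewrite /= /ball/= sub0r normrN gtr0_norm // => /(_ ltac:(lra) (lt0r_neq0 h0)).
by rewrite /GRing.scale/= mulr1 pmulr_rlt0 ?invr_gt0 // subr_lt0.
Qed.

(** A minimum of [f] on the interval is at most [f x1 <= 0], where [f] is still
    strictly decreasing; so it can only be the right end point. *)
Lemma barrier f df x1 x2 : x1 < x2 ->
  (forall x, x1 <= x <= x2 -> is_derive x 1 f (df x)) ->
  (forall x, x1 <= x < x2 -> f x <= 0 -> df x < 0) ->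
  f x1 <= 0 -> f x2 < f x1.
Proof.
move=> x12 fD df0 f1.
have [c] := EVT_min (ltW x12) (is_derive_continuous fD).
rewrite in_itv/= => /andP[c1 c2] cmin.
have desc x : x1 <= x -> x < x2 -> f x <= 0 -> exists2 y, x1 <= y <= x2 & f y < f x.
  move=> xx1 xx2 fx.
  have dx : is_derive x 1 f (df x) by apply: fD; rewrite xx1 ltW.
  have dx0 : df x < 0 by apply: df0 => //; rewrite xx1.
  have [y [xy yx2 fy]] := is_derive_neg_descent dx dx0 xx2.
  by exists y => //; rewrite (le_trans xx1) ?ltW.
have [y1 y1x fy1] := desc x1 (lexx _) x12 f1.
have c1le : f c <= f x1 by apply: cmin; rewrite in_itv/=; lra.
have cx2 : c = x2.
  apply/eqP; rewrite eq_le c2 leNgt; apply/negP => cx2.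
  have [y yx fy] := desc c c1 cx2 (le_trans c1le f1).
  by have := cmin y; rewrite in_itv/= => /(_ yx); lra.
by rewrite -cx2 (le_lt_trans _ fy1) // cmin // in_itv/=; lra.
Qed.

Lemma is_derive_decr f df (a b : R) : a < b ->
  (forall x, a <= x <= b -> is_derive x 1 f (df x)) ->
  (forall x, a < x < b -> df x < 0) -> f b < f a.
Proof.
move=> ab fD df0.
have [c cab] := MVT ab (fun x (xab : x \in `]a, b[) =>
  fD x (subset_itv_oo_cc xab)) (is_derive_continuous fD).
move: cab; rewrite in_itv/= => /df0 dc e.
by rewrite -subr_lt0 e pmulr_llt0 // subr_gt0.
Qed.

Lemma is_derive_incr f df (a b : R) : a < b ->
  (forall x, a <= x <= b -> is_derive x 1 f (df x)) ->
  (forall x, a < x < b -> 0 < df x) -> f a < f b.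
Proof.
move=> ab fD df0; rewrite -ltrN2.
apply: (@is_derive_decr (- f) (- df)) => // x xab; last by rewrite oppr_lt0 df0.
by have := fD x xab => ?; apply: is_derive_eq.
Qed.

(** If [f] were nonpositive at [x1], it would stay so, and eventually f / x^3 would
    decrease, because its equation has the damping k - 3 >= 0.  Then f <= - c x^3
    for some c > 0, which a quadratic lower bound excludes. *)
Lemma linear_ode_gt0 f (e k : R -> R) (x1 x3 C : R) : 0 < x1 -> 0 <= C ->
  (forall x, 0 < x -> is_derive x 1 f ((e x + k x * f x) / x)) ->
  (forall x, x1 <= x -> e x < 0) -> (forall x, x1 <= x -> 0 < k x) ->
  (forall x, x3 <= x -> 3 <= k x) ->
  (forall x, x3 <= x -> - (C * x ^+ 2) <= f x) -> 0 < f x1.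
Proof.
move=> x10 C0 fD e0 k0 k3 fC; rewrite ltNge; apply/negP => f1.
have [y y3 y1] : exists2 y, x3 <= y & x1 < y.
  exists (Num.max x3 x1 + 1); last by rewrite ltr_pwDr // le_max lexx orbT.
  by rewrite ler_wpDr // le_max lexx.
have fy : f y <= 0.
  apply: (le_trans _ f1); apply/ltW/(barrier y1 _ _ f1) => x xy; first by apply: fD; lra.
  move=> fx; rewrite pmulr_llt0 ?invr_gt0; last lra.
  by rewrite ltr_wnDr // ?e0 ?pmulr_rle0 ?k0 //; lra.
pose p x := f x / x ^+ 3.
have pD x : 0 < x -> is_derive x 1 p ((e x + (k x - 3) * f x) / x ^+ 4).
  move=> x0; have x30 : x ^+ 3 != 0 by rewrite expf_neq0 // gt_eqF.
  have d1 := fD x x0.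
  have d2 : is_derive x 1 ((id : R -> R) ^+ 3) (3 * x ^+ 2).
    by apply: is_derive_eq; rewrite /GRing.scale/= mulr1.
  have d3 := @is_deriveV _ ((id : R -> R) ^+ 3) x _ _ x30 d2.
  have -> : p = fun y => f y * (((id : R -> R) ^+ 3) y)^-1 by [].
  apply: is_derive_eq; rewrite /GRing.scale/=.
  by rewrite !exprfctE/=; field; rewrite gt_eqF.
have pneg x z : y <= x -> x < z -> p x <= 0 -> p z < p x.
  move=> yx xz px; apply: (barrier xz _ _ px) => s sx; first by apply: pD; lra.
  have s0 : 0 < s by lra.
  rewrite /p pmulr_lle0 ?invr_gt0 ?exprn_gt0 // => fs.
  rewrite pmulr_llt0 ?invr_gt0 ?exprn_gt0 //.
  have es : e s < 0 by apply: e0; lra.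
  have ks : 3 <= k s by apply: k3; lra.
  by rewrite ltr_wnDr // mulr_ge0_le0 //; lra.
have py : p y <= 0 by rewrite /p pmulr_lle0 ?invr_gt0 ?exprn_gt0 //; lra.
have p1 : p (y + 1) < 0 by apply: (lt_le_trans _ py); apply: pneg => //; lra.
(* Chosen so that p (y + 1) * z < - C. *)
pose z := y + 2 - C / p (y + 1).
have Cp : 0 <= - (C / p (y + 1)) by rewrite -mulrN mulr_ge0 // oppr_ge0 invr_le0 ltW.
have pz : p z < p (y + 1) by apply: pneg; rewrite /z; lra.
have z0 : 0 < z by rewrite /z; lra.
have : - (C * z ^+ 2) <= f z by apply: fC; rewrite /z; lra.
have -> : f z = p z * z * z ^+ 2 by rewrite /p; field; rewrite gt_eqF.
rewrite -mulNr ler_pM2r ?exprn_gt0 //.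
have : p z * z < p (y + 1) * z by rewrite ltr_pM2r.
have : p (y + 1) * z = p (y + 1) * (y + 2) - C by rewrite /z; field; rewrite lt_eqF.
have : p (y + 1) * (y + 2) < 0 by rewrite pmulr_llt0 //; lra.
lra.
Qed.

End Barrier.

(** * The envelope along a positive solution of the Riccati equation *)

Section Riccati.
Variables (R : realType) (nu : R) (u : R -> R).
Implicit Types (la x y : R).
Hypothesis nu_gt : 2^-1 < nu.
Hypothesis u_gt0 : forall x, 0 < x -> 0 < u x.
Hypothesis u_le : forall x, 0 < x -> u x <= x.
Hypothesis u_ode : forall x, 0 < x ->
  is_derive x 1 u ((u x * (u x + 2 * nu) - x ^+ 2) / x).

Let sqr_derive x : is_derive x 1 ((id : R -> R) ^+ 2) (2 * x).
Proof. by apply: is_derive_eq; rewrite /GRing.scale/= expr1 mulr1. Qed.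

(** The slope T = u (u + 2 nu) - x^2 satisfies x T' = (2 u + 2 nu) T - 2 x^2, so
    once nonpositive it stays so.  Then T / x + 2 x decreases, which gives
    T (2 x) < - 4 x^2, impossible for u > 0. *)
Lemma riccati_slope_gt0 x : 0 < x -> x ^+ 2 < u x * (u x + 2 * nu).
Proof.
have nu2 := nu_gt; move=> x0; rewrite ltNge; apply/negP => xle.
pose T y := u y * (u y + 2 * nu) - y ^+ 2.
have TD y : 0 < y ->
    is_derive y 1 T (((2 * u y + 2 * nu) * T y - 2 * y ^+ 2) / y).
  move=> y0; have d := u_ode y0; have d2 := sqr_derive y.
  have -> : T = fun z => u z * (u z + 2 * nu) - ((id : R -> R) ^+ 2) z by [].
  apply: is_derive_eq; rewrite /GRing.scale/= /T ?exprfctE/=.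
  by field; rewrite gt_eqF.
have Tx : T x <= 0 by rewrite subr_le0.
have Tneg y : x < y -> T y < 0.
  move=> xy; apply: (lt_le_trans _ Tx); apply: (barrier xy _ _ Tx) => z /andP[xz zy].
    by apply: TD; exact: lt_le_trans xz.
  have z0 : 0 < z by exact: lt_le_trans xz.
  move=> Tz; rewrite pmulr_llt0 ?invr_gt0 // subr_lt0.
  have z2 : 0 < z ^+ 2 by rewrite exprn_gt0.
  have uz := u_gt0 z0.
  have : (2 * u z + 2 * nu) * T z <= 0 by rewrite pmulr_rle0 //; lra.
  by lra.
have x2x : x < 2 * x by lra.
have : T (2 * x) / (2 * x) + 2 * (2 * x) < T x / x + 2 * x.
  apply: (@is_derive_decr _ (fun y => T y * y^-1 + 2 * y)
    (fun y => (2 * u y + 2 * nu - 1) * T y / y ^+ 2) _ _ x2x) => y /andP[xy yx].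
    have y0 : 0 < y by lra.
    have d := TD y y0.
    have d2 := @is_deriveV _ (id : R -> R) y _ _ (lt0r_neq0 y0) (is_derive_id _ _).
    by apply: is_derive_eq; rewrite /GRing.scale/=; field; rewrite gt_eqF.
  have y0 : 0 < y by lra.
  have uy := u_gt0 y0.
  by rewrite pmulr_llt0 ?invr_gt0 ?exprn_gt0 // pmulr_rlt0 ?Tneg //; lra.
have : T x / x <= 0 by rewrite pmulr_lle0 ?invr_gt0.
have : - (2 * x) < T (2 * x) / (2 * x).
  rewrite ltr_pdivlMr; last lra.
  have u2 : 0 < u (2 * x) by apply: u_gt0; lra.
  have : 0 < u (2 * x) * (u (2 * x) + 2 * nu) by rewrite mulr_gt0 //; lra.
  by rewrite /T; lra.
by lra.
Qed.

Lemma riccati_incr x y : 0 < x -> x < y -> u x < u y.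
Proof.
move=> x0 xy; apply: (is_derive_incr xy) => z /andP[xz zy].
  by apply: u_ode; exact: lt_le_trans xz.
have z0 : 0 < z by exact: lt_trans xz.
by rewrite divr_gt0 // subr_gt0 riccati_slope_gt0.
Qed.

Lemma riccati_ge x : 0 < x -> x - nu < u x.
Proof.
move=> x0; have := riccati_slope_gt0 x0; have := u_gt0 x0; have := nu_gt.
by rewrite ltNge => nu2 ux T; apply/negP => ule; nra.
Qed.

(** The quantity r that monitors the sign of the source term: for la < nu it
    decreases from 1 to 0 as u increases. *)
Definition weight la x := (nu - la) / (u x + (nu - la)).

(** The sign of the derivative of [envelope] ([is_derive_envelope]), normalised so
    that it satisfies a linear equation ([is_derive_crit]). *)
Definition crit la x := u x * (u x + 2 * nu - 1 - weight la x) - x ^+ 2.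

Definition drift la x := (1 - weight la x) * ((1 + weight la x) ^+ 2 - 2 * la).
Definition damp la x := 2 * u x + 2 * nu + 1 - weight la x ^+ 2.

Lemma weight_den_gt0 la x : la <= nu -> 0 < x -> 0 < u x + (nu - la).
Proof. by move=> lan x0; have := u_gt0 x0; lra. Qed.

Lemma weight_ge0 la x : la <= nu -> 0 < x -> 0 <= weight la x.
Proof. by move=> lan x0; rewrite divr_ge0 ?(ltW (weight_den_gt0 lan x0)) // subr_ge0. Qed.

Lemma weight_lt1 la x : la <= nu -> 0 < x -> weight la x < 1.
Proof.
by move=> lan x0; rewrite ltr_pdivrMr ?weight_den_gt0 // mul1r; have := u_gt0 x0; lra.
Qed.

(** Replacing x^2 by u (u + 2 nu - 1 - r) - crit in the Riccati equation gives
    x u' = u (1 + r) + crit, hence an equation that is linear in [crit]. *)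
Lemma is_derive_crit la x : la <= nu -> 0 < x ->
  is_derive x 1 (crit la) ((u x * drift la x + damp la x * crit la x) / x).
Proof.
move=> lan x0; have d := u_ode x0; have d2 := sqr_derive x.
have den := lt0r_neq0 (weight_den_gt0 lan x0).
have d3 := @is_deriveV _ (fun y => u y + (nu - la)) x _ _ den (is_deriveD d (is_derive_cst _ _ _)).
have -> : crit la = fun y => u y * (u y + 2 * nu - 1 -
  (nu - la) * (fun y => (u y + (nu - la))^-1) y) - ((id : R -> R) ^+ 2) y by [].
apply: is_derive_eq; rewrite /GRing.scale/= /drift /damp /crit /weight ?exprfctE/=.
by field; rewrite den gt_eqF.
Qed.

Lemma damp_gt la x : la <= nu -> 0 < x -> 2 * u x + 2 * nu < damp la x.
Proof.
move=> lan x0; have r0 := weight_ge0 lan x0; have r1 := weight_lt1 lan x0.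
by rewrite /damp; nra.
Qed.

Lemma drift_gt0 la x : la <= nu -> 0 < x ->
  2 * la < (1 + weight la x) ^+ 2 -> 0 < drift la x.
Proof.
by move=> lan x0 h; rewrite mulr_gt0 // subr_gt0 // weight_lt1.
Qed.

Lemma drift_lt0 la x : la <= nu -> 0 < x ->
  (1 + weight la x) ^+ 2 < 2 * la -> drift la x < 0.
Proof.
by move=> lan x0 h; rewrite pmulr_rlt0 ?subr_lt0 // subr_gt0 weight_lt1.
Qed.

(** Once u > 1, the damping is at least 3 and crit >= - x^2, so [linear_ode_gt0]
    applies. *)
Lemma crit_gt0_of_drift la x : la <= nu -> 0 < x ->
  (forall y, x <= y -> drift la y < 0) -> 0 < crit la x.
Proof.
have nu2 := nu_gt; move=> lan x0 dr.
have pos y : x <= y -> 0 < y by exact: lt_le_trans.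
have far y : nu + 1 <= y -> 0 < y /\ 1 < u y.
  by move=> ny; have y0 : 0 < y by [lra]; have := riccati_ge y0; split => //; lra.
have C0 : 0 <= 1 :> R by [].
apply: (linear_ode_gt0 (f := crit la) (e := fun y => u y * drift la y) (k := damp la)
  x0 C0 (x3 := nu + 1)).
- by move=> y y0; exact: is_derive_crit.
- by move=> y xy; rewrite pmulr_rlt0 ?dr // u_gt0 // pos.
- by move=> y xy; have := damp_gt lan (pos y xy); have := u_gt0 (pos y xy); lra.
- by move=> y /far[y0 uy]; have := damp_gt lan y0; lra.
- move=> y /far[y0 uy]; rewrite mul1r /crit.
  have : 0 <= u y * (u y + 2 * nu - 1 - weight la y).
    by rewrite mulr_ge0 //; have := weight_lt1 lan y0; lra.
  by lra.
Qed.

(** The mirror image of [crit_gt0_of_drift]: here u <= x provides the quadratic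
    upper bound on [crit]. *)
Lemma crit_lt0_of_drift la x : la <= nu -> 0 < x ->
  (forall y, x <= y -> 0 < drift la y) -> crit la x < 0.
Proof.
have nu2 := nu_gt; move=> lan x0 dr; rewrite -oppr_gt0.
have pos y : x <= y -> 0 < y by exact: lt_le_trans.
have far y : nu + 1 <= y -> 0 < y /\ 1 < u y.
  by move=> ny; have y0 : 0 < y by [lra]; have := riccati_ge y0; split => //; lra.
have C0 : 0 <= 1 + 2 * nu by lra.
apply: (linear_ode_gt0 (f := fun y => - crit la y)
  (e := fun y => - (u y * drift la y)) (k := damp la) x0 C0 (x3 := nu + 1)).
- move=> y y0; have d := is_derive_crit lan y0.
  by apply: is_derive_eq; field; rewrite gt_eqF.
- by move=> y xy; rewrite oppr_lt0 mulr_gt0 ?dr // u_gt0 // pos.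
- by move=> y xy; have := damp_gt lan (pos y xy); have := u_gt0 (pos y xy); lra.
- by move=> y /far[y0 uy]; have := damp_gt lan y0; lra.
- move=> y ny; have [y0 uy] := far y ny.
  have := weight_ge0 lan y0; have := u_le y0; rewrite lerN2 /crit => uley r0.
  have : u y * (1 + weight la y) >= 0 by rewrite mulr_ge0; lra.
  have : u y * (u y + 2 * nu) <= y * (y + 2 * nu) by rewrite ler_pM; lra.
  have : nu * y <= nu * y ^+ 2 by rewrite ler_pM2l; nra.
  by have : 0 <= y ^+ 2; [exact: sqr_ge0|lra].
Qed.

Lemma weight_decr la x y : la < nu -> 0 < x -> x < y -> weight la y < weight la x.
Proof.
move=> lan x0 xy; rewrite /weight ltr_pM2l ?subr_gt0 //.
have y0 := lt_trans x0 xy.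
rewrite ltf_pV2 ?posrE ?weight_den_gt0 ?(ltW lan) // ltrD2r.
exact: riccati_incr.
Qed.

(** If the source is negative at [y], it stays negative, and [crit] is positive from
    [y] on in any case.  Otherwise the source is positive before [y], where
    [crit] increases as long as it is nonnegative. *)
Lemma crit_gt0_after la x y : la < nu -> 0 < x -> x < y -> 0 <= crit la x -> 0 < crit la y.
Proof.
have nu2 := nu_gt; move=> lan x0 xy cx; have lan' := ltW lan; have y0 := lt_trans x0 xy.
have [ry|ry] := ltP ((1 + weight la y) ^+ 2) (2 * la).
  apply: crit_gt0_of_drift => // z yz; apply: drift_lt0 => //; first exact: lt_le_trans yz.
  apply: le_lt_trans ry.
  have z0 : 0 < z by exact: lt_le_trans yz.
  have rz := weight_ge0 lan' z0.
  rewrite ler_sqr ?nnegrE ?addr_ge0 ?weight_ge0 // lerD2l.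
  move: yz; rewrite le_eqVlt => /predU1P[->//|yz].
  exact/ltW/weight_decr.
apply: (le_lt_trans cx); rewrite -ltrN2.
apply: (barrier (f := fun z => - crit la z)
  (df := fun z => - ((u z * drift la z + damp la z * crit la z) / z)) xy).
- move=> z /andP[xz _]; have z0 := lt_le_trans x0 xz.
  by have d := is_derive_crit lan' z0; exact: is_deriveN.
- move=> z /andP[xz zy]; rewrite !oppr_le0 oppr_lt0 => cz; have z0 := lt_le_trans x0 xz.
  rewrite divr_gt0 // ltr_wpDr //.
    by rewrite mulr_ge0 //; have := damp_gt lan' z0; have := u_gt0 z0; lra.
  rewrite mulr_gt0 ?u_gt0 //; apply: drift_gt0 => //; apply: (le_lt_trans ry).
  rewrite ltr_sqr ?nnegrE ?addr_ge0 ?weight_ge0 // ltrD2l.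
  exact: weight_decr.
- by rewrite oppr_le0.
Qed.

(** As r tends to 0, the factor (1 + r)^2 - 2 la becomes negative. *)
Lemma crit_eventually_gt0 la : 2^-1 < la -> la < nu ->
  exists2 x0, 0 < x0 & forall x, x0 <= x -> 0 < crit la x.
Proof.
have nu2 := nu_gt; move=> la2 lan; have lan' := ltW lan.
have la0 : 0 < 2 * la - 1 by lra.
(* As r < 1, (1 + r)^2 <= 1 + 3 r, so r < (2 la - 1) / 3 suffices; u > c
   ensures it. *)
pose c := 3 * (nu - la) / (2 * la - 1).
have c0 : 0 <= c by rewrite divr_ge0 //; lra.
exists (nu + c); first by lra.
move=> x xc; have x0 : 0 < x by lra.
apply: crit_gt0_of_drift => // y xy; have y0 : 0 < y by lra.
apply: drift_lt0 => //.
have r1 := weight_lt1 lan' y0; have r0 := weight_ge0 lan' y0.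
have : weight la y < (2 * la - 1) / 3; last by nra.
rewrite ltr_pdivrMr ?weight_den_gt0 //.
have : c < u y by have := riccati_ge y0; lra.
rewrite ltr_pdivrMr // => h.
by have : 0 <= (2 * la - 1) * (nu - la); [rewrite mulr_ge0; lra|lra].
Qed.

(** Here the source term (1 - r) ((1 + r)^2 - 1) is positive everywhere. *)
Lemma crit_half_lt0 x : 0 < x -> crit 2^-1 x < 0.
Proof.
have nu2 := nu_gt; move=> x0; apply: crit_lt0_of_drift => // [|y xy]; first exact: ltW.
have y0 := lt_le_trans x0 xy.
apply: drift_gt0 => //; first exact: ltW.
have : 0 < weight 2^-1 y by rewrite divr_gt0 ?weight_den_gt0 ?subr_gt0 // ltW.
by nra.
Qed.

(** Here the source term (1 - r) ((1 + r)^2 - 4) is negative everywhere. *)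
Lemma crit_two_gt0 x : 2 <= nu -> 0 < x -> 0 < crit 2 x.
Proof.
move=> n2 x0; apply: crit_gt0_of_drift => // y xy.
have y0 := lt_le_trans x0 xy.
apply: drift_lt0 => //.
by have := weight_ge0 n2 y0; have := weight_lt1 n2 y0; nra.
Qed.

Lemma crit_incr_la la mu x : la < mu -> mu <= nu -> 0 < x -> crit la x < crit mu x.
Proof.
move=> lam mun x0; have lan := le_trans (ltW lam) mun.
rewrite ltrD2r ltr_pM2l ?u_gt0 // ltrD2l ltrN2.
rewrite /weight ltr_pdivrMr ?weight_den_gt0 // mulrAC ltr_pdivlMr ?weight_den_gt0 //.
have : 0 < u x * (mu - la) by rewrite mulr_gt0 ?u_gt0 // subr_gt0.
lra.
Qed.

(** The largest constant for which the bound holds at [x] ([boundK_ratioK_cmp]). *)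
Definition envelope la x := u x * (u x + 2 * (nu - la)) / x ^+ 2.

Lemma envelope_gt0 la x : la <= nu -> 0 < x -> 0 < envelope la x.
Proof.
move=> lan x0; rewrite divr_gt0 ?exprn_gt0 // mulr_gt0 ?u_gt0 //.
by have := u_gt0 x0; lra.
Qed.

Lemma is_derive_envelope la x : la <= nu -> 0 < x ->
  is_derive x 1 (envelope la) (2 * (u x + (nu - la)) * crit la x / x ^+ 3).
Proof.
move=> lan x0; have d := u_ode x0; have d2 := sqr_derive x.
have den := lt0r_neq0 (weight_den_gt0 lan x0).
have x2 : ((id : R -> R) ^+ 2) x != 0 by rewrite exprfctE expf_neq0 // gt_eqF.
have d3 := @is_deriveV _ ((id : R -> R) ^+ 2) x _ _ x2 d2.
have -> : envelope la = fun y => u y * (u y + 2 * (nu - la)) *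
  (((id : R -> R) ^+ 2) y)^-1 by [].
apply: is_derive_eq; rewrite /GRing.scale/= /crit /weight !exprfctE/=.
by field; rewrite den gt_eqF.
Qed.

Lemma crit_zero_exists la x : 2^-1 < la -> la < nu -> 0 < x -> crit la x < 0 ->
  exists2 y, 0 < y & crit la y = 0.
Proof.
move=> la2 lan x0 cx.
have [z z0 hz] := crit_eventually_gt0 la2 lan.
pose w := Num.max x z.
have xw : x <= w by rewrite le_max lexx.
have cw : 0 < crit la w by apply: hz; rewrite le_max lexx orbT.
have cont : {within `[x, w], continuous (crit la)}.
  apply: is_derive_continuous => y /andP[xy _].
  by apply: is_derive_crit; [exact: ltW|exact: lt_le_trans xy].
have [|y yxw cy] := IVT xw cont (v := 0).
  by rewrite ge_min le_max (ltW cx) (ltW cw) orbT.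
exists y => //; move: yxw; rewrite in_itv/= => /andP[xy _].
exact: lt_le_trans xy.
Qed.

Lemma crit_sign la x y : la < nu -> 0 < x -> 0 < y -> crit la x = 0 ->
  (crit la y < 0) = (y < x) /\ (0 < crit la y) = (x < y).
Proof.
move=> lan x0 y0 cx; have [yx|xy|->] := ltgtP y x; last by rewrite cx ltxx.
  have cy : crit la y < 0.
    rewrite ltNge; apply/negP => cy.
    by have := crit_gt0_after lan y0 yx cy; rewrite cx ltxx.
  by rewrite cy ltNge ltW.
have cy : 0 < crit la y by apply: (crit_gt0_after lan x0 xy); rewrite cx.
by rewrite cy ltNge ltW.
Qed.

Lemma envelope_min la x y : la < nu -> 0 < x -> 0 < y -> crit la x = 0 -> y != x ->
  envelope la x < envelope la y.
Proof.
move=> lan x0 y0 cx; have lan' := ltW lan.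
have f0 z : 0 < z -> 0 < 2 * (u z + (nu - la)) by move=> z0; rewrite mulr_gt0 // weight_den_gt0.
rewrite neq_lt => /orP[yx|xy].
  apply: (is_derive_decr yx) => z /andP[yz zx]; have z0 : 0 < z by lra.
    exact: is_derive_envelope.
  rewrite pmulr_llt0 ?invr_gt0 ?exprn_gt0 // pmulr_rlt0 ?f0 //.
  by have [-> _] := crit_sign lan x0 z0 cx.
apply: (is_derive_incr xy) => z /andP[xz zy]; have z0 : 0 < z by lra.
  exact: is_derive_envelope.
rewrite divr_gt0 ?exprn_gt0 // mulr_gt0 ?f0 //.
by have [_ ->] := crit_sign lan x0 z0 cx.
Qed.

End Riccati.

(** * Behaviour of the Bessel ratio near 0 *)

Section BesselCritical.
Variable R : realType.
Implicit Types (nu la mu x y c : R).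

(** Y = redratio + 2 mu = x K_(mu+1) / K_mu is positive and satisfies
    x Y' = Y (Y - 2 mu) - x^2.  If Y stayed above [beta], the right-hand side would
    stay above a positive constant c / 2, so Y - (c / 2) ln x would increase and Y
    would be negative close to 0. *)
Lemma redratio_near0 mu beta x0 : 0 < beta -> 2 * mu < beta -> 0 < x0 ->
  exists x, [/\ 0 < x, x < x0 & redratio mu x + 2 * mu < beta].
Proof.
move=> b0 mub x00; apply: contrapT => no.
pose Y x := redratio mu x + 2 * mu.
have Yge x : 0 < x -> x < x0 -> beta <= Y x.
  by move=> xp xx0; rewrite leNgt; apply/negP => Yx; apply: no; exists x.
have YD x : 0 < x -> is_derive x 1 Y ((Y x * (Y x - 2 * mu) - x ^+ 2) / x).
  move=> xp; have d := is_derive_redratio mu xp.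
  by apply: is_derive_eq; rewrite /Y; ring.
clearbody Y; clear no.
pose c := beta * (beta - 2 * mu).
have c0 : 0 < c by rewrite mulr_gt0 // subr_gt0.
pose x1 := Num.min (x0 / 2) (Num.min 1 (c / 2)).
have x10 : 0 < x1 by rewrite !lt_min ltr01 !divr_gt0.
have x11 : x1 <= x0 / 2 by rewrite ge_min lexx.
have x12 : x1 <= 1 by rewrite !ge_min lexx !orbT.
have x13 : x1 <= c / 2 by rewrite !ge_min lexx !orbT.
clearbody x1.
have x1x0 : x1 < x0 by lra.
have Y1 : 0 < Y x1 by apply: (lt_le_trans b0); exact: Yge.
have cY y : beta <= y -> c <= y * (y - 2 * mu).
  move=> yb; rewrite ler_pM ?(ltW b0) ?subr_ge0 ?(ltW mub) //.
  by rewrite lerD2r.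
clearbody c.
(* Going down from x1 by the factor exp (- M) costs exactly (c / 2) M = Y x1. *)
pose M := 2 * Y x1 / c.
have M0 : 0 < M by rewrite divr_gt0 // mulr_gt0.
have cM : c / 2 * M = Y x1 by rewrite /M; field; rewrite gt_eqF.
clearbody M.
pose x := x1 * expR (- M).
have xp : 0 < x by rewrite mulr_gt0 ?expR_gt0.
have xx1 : x < x1 by rewrite -[ltRHS]mulr1 ltr_pM2l // expR_lt1 oppr_lt0.
have lnx : ln x = ln x1 - M by rewrite lnM ?posrE ?expR_gt0 // expRK.
clearbody x.
have : Y x - c / 2 * ln x < Y x1 - c / 2 * ln x1.
  apply: (@is_derive_incr _ (fun z => Y z - c / 2 * ln z)
    (fun z => (Y z * (Y z - 2 * mu) - z ^+ 2 - c / 2) / z) _ _ xx1) => z /andP[xz zx].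
    have z0 : 0 < z by exact: lt_le_trans xz.
    have d := YD z z0; have d2 := is_derive1_ln z0.
    by apply: is_derive_eq; rewrite /GRing.scale/=; field; rewrite gt_eqF.
  have z0 : 0 < z by exact: lt_trans xz.
  have Yz := cY _ (Yge z z0 (lt_trans zx x1x0)).
  have z2 : z ^+ 2 <= z by rewrite expr2 ler_piMr ?(ltW z0) // ltW // (lt_le_trans zx).
  rewrite divr_gt0 //; move: Yz; clear -zx x13 z2.
  by move: (Y z * _) => v; lra.
rewrite lnx; have Yx := Yge x xp (lt_trans xx1 x1x0).
by clear -cM Yx b0; lra.
Qed.

(** The sign of crit / u, where [u], [w] and [z - 2 (nu - 2)] stand for the
    reduced ratios of orders nu, nu - 1 and nu - 2; the equation between them holds
    because both sides are x^2. *)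
Lemma crit_sign_algebra (nu la u w z : R) : 1 < nu -> la < 2 -> la < nu ->
  0 < u -> 0 < w -> u * (w + 2 * (nu - 1)) = w * z ->
  z < 2 * (nu - 1) * (nu - la) / (nu - la + 1) ->
  u + 2 * nu - 1 - (nu - la) / (u + (nu - la)) - (w + 2 * (nu - 1)) < 0.
Proof.
move=> nu1 la2 lan u0 w0 e zb.
have : 0 < nu - la by rewrite subr_gt0.
move: zb; move: (nu - la) => a zb a0.
have uwz : u * (2 * (nu - 1)) < w * z.
  by rewrite -e ltr_pM2l // ltrDr.
have uw : u * (a + 1) < w * a.
  have n0 : 0 < 2 * (nu - 1) by lra.
  have a1 : 0 < a + 1 by lra.
  move: zb uwz n0; rewrite ltr_pdivlMr //; move: (2 * (nu - 1)) => n zb uwz n0.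
  have : w * (z * (a + 1)) < w * (n * a) by rewrite ltr_pM2l.
  have : u * n * (a + 1) < w * z * (a + 1) by rewrite ltr_pM2r.
  by move=> h1 h2; rewrite -(ltr_pM2r n0); lra.
have : u / (u + a) < u / a by rewrite ltr_pM2l // ltf_pV2 ?posrE ?addr_gt0 // ltrDr.
have : u / a + u < w by rewrite -(ltr_pM2r a0) mulrDl divfK ?gt_eqF //; lra.
have -> : a / (u + a) = 1 - u / (u + a) by field; rewrite gt_eqF // addr_gt0.
by lra.
Qed.

(** For nu > 1, [crit_sign_algebra] applies, since the threshold
    2 (nu - 1) (nu - la) / (nu - la + 1) exceeds 2 (nu - 2) exactly when la < 2.  For nu <= 1, the envelope is unbounded near
    0, so it cannot be increasing on the whole half-line. *)
Lemma crit_bessel_lt0 nu la : 2^-1 < nu -> la < 2 -> la < nu ->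
  exists2 x, 0 < x & crit nu (redratio nu) la x < 0.
Proof.
move=> nu2 la2 lan; have a0 : 0 < nu - la by rewrite subr_gt0.
have [nu1|nu1] := ltP 1 nu.
- have a1 : 0 < nu - la + 1 by rewrite addr_gt0.
  have b0 : 0 < 2 * (nu - 1) * (nu - la) / (nu - la + 1).
    by rewrite divr_gt0 ?mulr_gt0 // subr_gt0.
  have b2 : 2 * (nu - 2) < 2 * (nu - 1) * (nu - la) / (nu - la + 1).
    by rewrite ltr_pdivlMr //; nra.
  have [x [x0 _ zb]] := redratio_near0 b0 b2 ltr01.
  exists x => //.
  have s1 := redratio_shift nu x0; have s2 := redratio_shift (nu - 1) x0.
  have e2 : nu - 1 - 1 = nu - 2 by ring.
  rewrite e2 -s1 in s2.
  have u0 := redratio_gt0 nu x0; have w0 := redratio_gt0 (nu - 1) x0.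
  rewrite /crit /weight -s1 -mulrBr pmulr_rlt0 //.
  exact: (crit_sign_algebra nu1 la2 lan u0 w0 (esym s2) zb).
- apply: contrapT => no.
  have up := redratio_gt0 nu; have ul := redratio_le (ltW nu2).
  have ud := @is_derive_redratio R nu.
  have cpos x : 0 < x -> 0 < crit nu (redratio nu) la x.
    move=> x0; have x20 : 0 < x / 2 by lra.
    have xx : x / 2 < x by lra.
    apply: (crit_gt0_after nu2 up ud lan x20 xx).
    by rewrite leNgt; apply/negP => cx; apply: no; exists (x / 2).
  have : 0 < envelope nu (redratio nu) la 1 by apply: envelope_gt0 => //; exact: ltW.
  have F1 x : 0 < x -> x < 1 -> envelope nu (redratio nu) la x < envelope nu (redratio nu) la 1.
    move=> x0 x1; apply: (is_derive_incr x1) => z /andP[xz _].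
      by apply: is_derive_envelope => //; [exact: ltW|exact: lt_le_trans xz].
    have z0 := lt_trans x0 xz.
    rewrite divr_gt0 ?exprn_gt0 // mulr_gt0 ?cpos // mulr_gt0 //.
    by rewrite addr_gt0 ?redratio_gt0.
  move: F1; move: (envelope _ _ _ 1) => M F1 M0.
  have b0 : 0 < 2 * (nu - la) / M by rewrite divr_gt0 // mulr_gt0.
  have b2 : 2 * (nu - 1) < 2 * (nu - la) / M.
    by apply: le_lt_trans b0; rewrite pmulr_rle0 // subr_le0.
  have [x [x0 x1 zb]] := redratio_near0 b0 b2 ltr01.
  have := F1 x x0 x1.
  have u0 := up x x0; have s1 := redratio_shift nu x0.
  have z0 : 0 < redratio (nu - 1) x + 2 * (nu - 1).
    by rewrite -(pmulr_rgt0 _ u0) s1 exprn_gt0.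
  rewrite /envelope -s1 -mulf_div divff ?gt_eqF // mul1r ltr_pdivrMr //.
  move: zb z0 u0; rewrite ltr_pdivlMr //.
  move: (redratio nu x) (redratio (nu - 1) x + _); clear; move=> u z.
  by rewrite mulrC; lra.
Qed.

Lemma ratioK_boundK nu la x : 0 < x -> la <= nu ->
  ratioK nu x = x^-1 * (nu + la +
    Num.sqrt ((nu - la) ^+ 2 + envelope nu (redratio nu) la x * x ^+ 2)).
Proof.
move=> x0 lan; have u0 := redratio_gt0 nu x0.
rewrite /envelope divfK ?expf_neq0 ?gt_eqF //.
have -> : (nu - la) ^+ 2 + redratio nu x * (redratio nu x + 2 * (nu - la)) =
  (redratio nu x + (nu - la)) ^+ 2 by ring.
rewrite sqrtr_sqr ger0_norm; last lra.
by rewrite ratioKE // mulrC; congr (_ * _); ring.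
Qed.

End BesselCritical.

(** * The best constant and the contact point *)

Section Best.
Variables (R : realType) (nu : R).
Implicit Types (la x y c : R).
Hypothesis nu_gt : 2^-1 < nu.

Let u : R -> R := redratio nu.
Let up : forall x, 0 < x -> 0 < u x := @redratio_gt0 R nu.
Let ul x (x0 : 0 < x) : u x <= x := redratio_le (ltW nu_gt) x0.
Let ud x (x0 : 0 < x) : is_derive x 1 u ((u x * (u x + 2 * nu) - x ^+ 2) / x) :=
  is_derive_redratio nu x0.

(** The default value 0 is only taken outside the range of la where the zero exists. *)
Definition contact_pt la : R := xget 0 [set x | 0 < x /\ crit nu (redratio nu) la x = 0].
Definition best_const la : R := envelope nu (redratio nu) la (contact_pt la).

Lemma contact_ptP la : 2^-1 < la -> la < 2 -> la < nu ->
  0 < contact_pt la /\ crit nu u la (contact_pt la) = 0.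
Proof.
move=> la1 la2 lan; have [x x0 cx] := crit_bessel_lt0 nu_gt la2 lan.
have [y y0 cy] := crit_zero_exists nu_gt up ud la1 lan x0 cx.
by rewrite /contact_pt; case: xgetP => [z _ //|/(_ y)[]].
Qed.

Lemma best_const_lt la x : 2^-1 < la -> la < 2 -> la < nu -> 0 < x -> x != contact_pt la ->
  best_const la < envelope nu u la x.
Proof.
move=> la1 la2 lan x0 xX; have [X0 cX] := contact_ptP la1 la2 lan.
exact: (envelope_min nu_gt up ud).
Qed.

Lemma best_const_gt0 la : 2^-1 < la -> la < 2 -> la < nu -> 0 < best_const la.
Proof.
move=> la1 la2 lan; have [X0 _] := contact_ptP la1 la2 lan.
by apply: envelope_gt0 => //; exact: ltW.
Qed.

Lemma boundK_ratioK_cmp la x c : 0 < x -> la <= nu -> 0 <= c ->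
  (boundK nu la c x <= ratioK nu x) = (c <= envelope nu u la x) /\
  (ratioK nu x = boundK nu la c x <-> envelope nu u la x = c).
Proof.
move=> x0 lan c0; have F0 := envelope_gt0 up lan x0.
have x2 : 0 < x ^+ 2 by rewrite exprn_gt0.
have s0 : 0 <= (nu - la) ^+ 2 + envelope nu u la x * x ^+ 2.
  by rewrite addr_ge0 ?sqr_ge0 // mulr_ge0 ?ltW.
rewrite (ratioK_boundK x0 lan) /boundK; split.
  by rewrite ler_pM2l ?invr_gt0 // lerD2l ler_sqrt // lerD2l ler_pM2r.
split=> [|<-//].
have xV : x^-1 != 0 by rewrite invr_neq0 // gt_eqF.
move=> /(mulfI xV) /addrI /eqP.
rewrite eqr_sqrt //; first by move=> /eqP /addrI /(mulIf (lt0r_neq0 x2)).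
by rewrite addr_ge0 ?sqr_ge0 // mulr_ge0 // ltW.
Qed.

Lemma derivable_ratioK x : 0 < x -> derivable (ratioK nu) x 1.
Proof.
move=> x0; have d1 := is_derive_besselK (nu + 1) x0.
have d2 := is_deriveV (lt0r_neq0 (besselK_gt0 nu x0)) (is_derive_besselK nu x0).
have [] // := is_deriveM d1 d2.
Qed.

Lemma derivable_boundK la c x : 0 < x -> la < nu -> 0 <= c -> derivable (boundK nu la c) x 1.
Proof.
move=> x0 lan c0.
have s0 : 0 < (nu - la) ^+ 2 + c * x ^+ 2.
  by rewrite ltr_pwDl ?exprn_gt0 ?subr_gt0 // mulr_ge0 // sqr_ge0.
have d1 : is_derive x 1 (fun y => (nu - la) ^+ 2 + c * ((id : R -> R) ^+ 2) y) (c * (2 * x)).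
  by apply: is_derive_eq; rewrite /GRing.scale/= expr1; ring.
have d2 : is_derive x 1 (fun y => Num.sqrt ((nu - la) ^+ 2 + c * ((id : R -> R) ^+ 2) y)) _ :=
  @is_derive1_comp _ Num.sqrt _ x _ _ (is_derive1_sqrt s0) d1.
have d3 := @is_deriveV _ (id : R -> R) x _ _ (lt0r_neq0 x0) (is_derive_id x (1 : R)).
by have [] := is_deriveM d3 (is_deriveD (is_derive_cst (nu + la) x 1) d2).
Qed.

(** The difference of the ratio and the bound has a minimum at the contact point. *)
Lemma contact_pt_tangent la : 2^-1 < la -> la < 2 -> la < nu ->
  derive1 (ratioK nu) (contact_pt la) = derive1 (boundK nu la (best_const la)) (contact_pt la).
Proof.
move=> la1 la2 lan; have [X0 _] := contact_ptP la1 la2 lan.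
have C0 := ltW (best_const_gt0 la1 la2 lan).
have [dr db] := (derivable_ratioK X0, derivable_boundK X0 lan C0).
have itv t : t \in `](contact_pt la / 2), (2 * contact_pt la)[ -> 0 < t.
  by rewrite in_itv/= => /andP[t1 _]; apply: lt_trans t1; rewrite divr_gt0.
have : is_derive (contact_pt la) 1 (ratioK nu - boundK nu la (best_const la)) 0.
  apply: (@derive1_at_min _ _ (contact_pt la / 2) (2 * contact_pt la)).
  - by lra.
  - by move=> t /itv t0; apply: derivableB; [exact: derivable_ratioK|exact: derivable_boundK].
  - by rewrite in_itv/=; apply/andP; split; lra.
  - move=> t /itv t0.
    have [_ [_ e]] := boundK_ratioK_cmp X0 (ltW lan) C0.
    have [le_t _] := boundK_ratioK_cmp t0 (ltW lan) C0.
    rewrite !fctE e // subrr subr_ge0 le_t.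
    have [->//|tX] := eqVneq t (contact_pt la).
    by rewrite ltW // best_const_lt.
move=> [_]; rewrite deriveB // !derive1E => /eqP.
by rewrite subr_eq0 => /eqP.
Qed.

Lemma best_const_decr la mu : 2^-1 < la -> la < mu -> mu < 2 -> mu < nu ->
  best_const mu < best_const la.
Proof.
move=> la1 lam mu2 mun.
have [la2 lan mu1] : [/\ la < 2, la < nu & 2^-1 < mu].
  by split; [exact: lt_trans mu2|exact: lt_trans mun|exact: lt_trans lam].
have [X0 cX] := contact_ptP la1 la2 lan; have [Y0 cY] := contact_ptP mu1 mu2 mun.
apply: (@le_lt_trans _ _ (envelope nu u mu (contact_pt la))).
  have [->//|XY] := eqVneq (contact_pt la) (contact_pt mu).
  by rewrite ltW // best_const_lt.
rewrite /best_const /envelope ltr_pM2r ?invr_gt0 ?exprn_gt0 // ltr_pM2l ?up //.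
by rewrite ltrD2l ltr_pM2l // ltrD2l ltrN2.
Qed.

Lemma contact_pt_decr la mu : 2^-1 < la -> la < mu -> mu < 2 -> mu < nu ->
  contact_pt mu < contact_pt la.
Proof.
move=> la1 lam mu2 mun.
have [la2 lan mu1] : [/\ la < 2, la < nu & 2^-1 < mu].
  by split; [exact: lt_trans mu2|exact: lt_trans mun|exact: lt_trans lam].
have [X0 cX] := contact_ptP la1 la2 lan; have [Y0 cY] := contact_ptP mu1 mu2 mun.
have [_ <-] := crit_sign nu_gt up ud mun Y0 X0 cY.
by rewrite -cX; apply: (crit_incr_la up) => //; exact: ltW.
Qed.

Lemma crit_continuous_la x mu : 0 < x -> mu <= nu ->
  crit nu u la x @[la --> mu] --> crit nu u mu x.
Proof.
move=> x0 mun; apply: cvgB; last exact: cvg_cst.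
apply: cvgMr; apply: cvgB; first exact: cvg_cst.
have ca : (nu - la) @[la --> mu] --> nu - mu by apply: cvgB; [exact: cvg_cst|exact: cvg_id].
apply: cvgM => //; apply: cvgV; first exact: lt0r_neq0 (weight_den_gt0 up mun x0).
by apply: cvgD => //; exact: cvg_cst.
Qed.

Lemma near_dom_half : \forall la \near 2^-1^'+, [/\ 2^-1 < la, la < 2 & la < nu].
Proof.
near=> la; split; near: la; [exact: nbhs_right_gt| |exact: nbhs_right_lt].
by apply: nbhs_right_lt; lra.
Unshelve. all: by end_near. Qed.

(** Every fixed x has crit < 0 at la = 1/2, hence for la close to 1/2; then x lies to
    the left of the contact point. *)
Lemma contact_pt_cvg_half : contact_pt la @[la --> 2^-1^'+] --> +oo.
Proof.
apply/cvgryPgt => A; pose x := Num.max A 1.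
have x0 : 0 < x by rewrite lt_max ltr01 orbT.
have Ax : A <= x by rewrite le_max lexx.
have cx : crit nu u 2^-1 x < 0 := crit_half_lt0 nu_gt up ul ud x0.
have cc := cvg_at_right_filter (crit_continuous_la x0 (ltW nu_gt)).
near=> la.
have [la1 la2 lan] : [/\ 2^-1 < la, la < 2 & la < nu] by near: la; exact: near_dom_half.
have [X0 cX] := contact_ptP la1 la2 lan.
apply: (le_lt_trans Ax); have [<- _] := crit_sign nu_gt up ud lan X0 x0 cX.
by near: la; exact: (cvgr_lt _ cc _ cx).
Unshelve. all: by end_near. Qed.

(** Since x - nu < u <= x, the constant lies between (1 - nu / x)^2 and 1 + 2 nu / x
    at the contact point x, which tends to infinity. *)
Lemma best_const_cvg_half : best_const la @[la --> 2^-1^'+] --> (1 : R).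
Proof.
have iX : (contact_pt la)^-1 @[la --> 2^-1^'+] --> (0 : R).
  apply/gtr0_cvgV0; last exact: contact_pt_cvg_half.
  by apply: filterS near_dom_half => la [la1 la2 lan]; case: (contact_ptP la1 la2 lan).
have lo : (1 - nu * (contact_pt la)^-1) ^+ 2 @[la --> 2^-1^'+] --> (1 : R).
  rewrite [X in _ --> X](_ : _ = (1 - nu * 0) ^+ 2); last by rewrite mulr0 subr0 expr1n.
  under eq_fun do rewrite expr2. rewrite expr2.
  have h : 1 - nu * (contact_pt la)^-1 @[la --> 2^-1^'+] --> 1 - nu * 0.
    by apply: cvgB; [exact: cvg_cst|exact: cvgMr].
  exact: cvgM.
have hi : 1 + 2 * nu * (contact_pt la)^-1 @[la --> 2^-1^'+] --> (1 : R).
  rewrite [X in _ --> X](_ : _ = 1 + 2 * nu * 0); last by rewrite mulr0 addr0.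
  by apply: cvgD; [exact: cvg_cst|exact: cvgMr].
apply: (squeeze_cvgr _ lo hi); near=> la.
have [la1 la2 lan] : [/\ 2^-1 < la, la < 2 & la < nu] by near: la; exact: near_dom_half.
have Xnu : nu < contact_pt la.
  near: la; move/cvgryPgt : contact_pt_cvg_half; exact.
have [X0 _] := contact_ptP la1 la2 lan.
rewrite /best_const /envelope.
have := riccati_ge nu_gt up ud X0; have := ul X0; have := up X0.
rewrite /u; move: (redratio nu _) => v; move: (contact_pt la) X0 Xnu => X X0 Xnu v0 vX Xv.
have X2 : 0 < X ^+ 2 by rewrite exprn_gt0.
rewrite ler_pdivlMr // ler_pdivrMr //.
have -> : (1 - nu * X^-1) ^+ 2 * X ^+ 2 = (X - nu) ^+ 2 by field; rewrite gt_eqF.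
have -> : (1 + 2 * nu * X^-1) * X ^+ 2 = X * (X + 2 * nu) by field; rewrite gt_eqF.
by apply/andP; split; have := nu_gt; nra.
Unshelve. all: by end_near. Qed.

Lemma near_dom_two : 2 <= nu -> \forall la \near 2^'-, [/\ 2^-1 < la, la < 2 & la < nu].
Proof.
move=> n2; near=> la.
have l2 : la < 2 by near: la; exact: nbhs_left_lt.
split => //; last exact: lt_le_trans n2.
near: la; apply: nbhs_left_gt.
by lra.
Unshelve. all: by end_near. Qed.

(** Every fixed x has crit > 0 at la = 2, hence for la close to 2; then x lies to
    the right of the contact point. *)
Lemma contact_pt_cvg_two : 2 <= nu -> contact_pt la @[la --> 2^'-] --> (0 : R).
Proof.
move=> n2; apply/cvgrPdist_lt => e e0.
have ce : 0 < crit nu u 2 e := crit_two_gt0 nu_gt up ud n2 e0.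
have cc := cvg_at_left_filter (crit_continuous_la e0 n2).
near=> la.
have [la1 la2 lan] : [/\ 2^-1 < la, la < 2 & la < nu] by near: la; exact: near_dom_two.
have [X0 cX] := contact_ptP la1 la2 lan.
rewrite sub0r normrN gtr0_norm //; have [_ <-] := crit_sign nu_gt up ud lan X0 e0 cX.
by near: la; exact: (cvgr_gt _ cc _ ce).
Unshelve. all: by end_near. Qed.

(** Writing x^2 = u (w + 2 (nu - 1)) turns the constant into
    (u + 2 (nu - la)) / (w + 2 (nu - 1)), where 0 < u, w <= x and the contact point
    x tends to 0. *)
Lemma best_const_cvg_two : 2 <= nu -> best_const la @[la --> 2^'-] --> (nu - 2) / (nu - 1).
Proof.
move=> n2; have cX := contact_pt_cvg_two n2.
have n1 : 0 < 2 * (nu - 1) by lra.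
have ca : 2 * (nu - la) @[la --> 2^'-] --> 2 * (nu - 2).
  apply: cvgMr; apply: cvgB; first exact: cvg_cst.
  by apply: cvg_at_left_filter; exact: cvg_id.
have lo : 2 * (nu - la) / (2 * (nu - 1) + contact_pt la) @[la --> 2^'-] --> (nu - 2) / (nu - 1).
  rewrite [X in _ --> X](_ : _ = 2 * (nu - 2) / (2 * (nu - 1) + 0)); last first.
    by rewrite addr0; field; lra.
  apply: cvgM => //; apply: cvgV; first by rewrite addr0 gt_eqF.
  by apply: cvgD => //; exact: cvg_cst.
have hi : (contact_pt la + 2 * (nu - la)) / (2 * (nu - 1)) @[la --> 2^'-] --> (nu - 2) / (nu - 1).
  rewrite [X in _ --> X](_ : _ = (0 + 2 * (nu - 2)) / (2 * (nu - 1))); last first.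
    by rewrite add0r; field; lra.
  by apply: cvgMl; exact: cvgD.
apply: (squeeze_cvgr _ lo hi); near=> la.
have [la1 la2 lan] : [/\ 2^-1 < la, la < 2 & la < nu] by near: la; exact: near_dom_two.
have [X0 _] := contact_ptP la1 la2 lan.
have nu1 : 2^-1 <= nu - 1 by lra.
rewrite /best_const /envelope -(redratio_shift nu X0).
have := redratio_le nu1 X0; have := redratio_gt0 (nu - 1) X0; have := ul X0; have := up X0.
rewrite /u; move: (redratio nu _) (redratio (nu - 1) _) => v w.
move: (contact_pt la) X0 => X X0 v0 vX w0 wX.
rewrite -mulf_div divff ?gt_eqF // mul1r [w + _]addrC.
have a0 : 0 < 2 * (nu - la) by lra.
have d0 : 0 < 2 * (nu - 1) + w by lra.
have d1 : 0 < 2 * (nu - 1) + X by lra.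
apply/andP; split.
- apply: ler_pM; [exact: ltW|by rewrite invr_ge0 ltW|by rewrite lerDr ltW|].
  by rewrite lef_pV2 ?posrE // lerD2l.
- apply: ler_pM; [by rewrite addr_ge0 ?ltW|by rewrite invr_ge0 ltW|by rewrite lerD2r|].
  by rewrite lef_pV2 ?posrE // lerDl ltW.
Unshelve. all: by end_near. Qed.

End Best.

Unset Implicit Arguments.

Theorem theorem13 (R : realType) (nu : R) (hnu : 2^-1 < nu) :
  exists C X : R -> R,
    [/\ forall la : R, 2^-1 < la -> la < 2 -> la < nu ->
          [/\ 0 < C la,
              0 < X la,
              forall x : R, 0 < x -> boundK nu la (C la) x <= ratioK nu x,
              forall x : R, 0 < x ->
                (ratioK nu x = boundK nu la (C la) x <-> x = X la)
            & [/\ derivable (ratioK nu) (X la) 1,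
                  derivable (boundK nu la (C la)) (X la) 1
                & derive1 (ratioK nu) (X la) = derive1 (boundK nu la (C la)) (X la)]],
        {in `]2^-1, (Num.min 2 nu)[ &, {homo C : l m /~ l < m}},
        {in `]2^-1, (Num.min 2 nu)[ &, {homo X : l m /~ l < m}},
        C la @[la --> 2^-1^'+] --> (1 : R) /\
        X la @[la --> 2^-1^'+] --> +oo
      & 2 <= nu ->
        C la @[la --> 2^'-] --> (nu - 2) / (nu - 1) /\
        X la @[la --> 2^'-] --> (0 : R)].
Proof.
exists (best_const nu), (contact_pt nu); split.
- move=> la la1 la2 lan; have [X0 _] := contact_ptP hnu la1 la2 lan.
  have C0 := best_const_gt0 hnu la1 la2 lan.
  have Cmin x : 0 < x -> x != contact_pt nu la -> best_const nu la < envelope nu (redratio nu) la x.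
    exact: best_const_lt.
  split => //.
  + move=> x x0; have [-> _] := boundK_ratioK_cmp x0 (ltW lan) (ltW C0).
    by have [->//|/Cmin] := eqVneq x (contact_pt nu la); move/(_ x0)/ltW.
  + move=> x x0; have [_ ->] := boundK_ratioK_cmp x0 (ltW lan) (ltW C0).
    split=> [e|->//]; apply/eqP/negPn/negP => /(Cmin x x0).
    by rewrite e ltxx.
  + split; [exact: derivable_ratioK|exact: (derivable_boundK X0 lan (ltW C0))|].
    exact: contact_pt_tangent.
- move=> l m; rewrite !in_itv/= !lt_min => /and3P[l1 l2 l3] /and3P[m1 m2 m3] ml.
  exact: best_const_decr.
- move=> l m; rewrite !in_itv/= !lt_min => /and3P[l1 l2 l3] /and3P[m1 m2 m3] ml.
  exact: contact_pt_decr.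
- by split; [exact: best_const_cvg_half|exact: contact_pt_cvg_half].
- by move=> n2; split; [exact: best_const_cvg_two|exact: contact_pt_cvg_two].
Qed.
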